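(* Let $A, B \in \mathbb{R}$ be constants with $A \neq 0$. The power series $u$ in the variable $w$ (with real coefficients) that solves the equation $$u = (A + B u^2) w$$ is given by $$u = \sum_{n=0}^\infty c_n A^{n+1} B^n w^{2n+1},$$ where $c_n$ is the $n$-th Catalan number.
   Context: Here $u$ is a formal power series in $w$, i.e. an element of $\mathbb{R}[[w]]$, and the equation is an identity in $\mathbb{R}[[w]]$. The convention $B^0 = 1$ is used (including when $B=0$). The Catalan numbers $c_n$ ($n \geq 0$) are defined by $c_0 = 1$ and $c_n = \sum_{i+j=n-1} c_i c_j$ for $n \geq 1$ (sum over nonnegative integers $i,j$); equivalently $c_n = \frac{1}{n+1}\binom{2n}{n}$. *)

(* Defs.v *)
From Stdlib Require Import Reals Lia List Arith.
From Coquelicot Require Import Coquelicot.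
Import ListNotations.
Open Scope R_scope.

(* An element of R[[w]] is its coefficient sequence. Coquelicot's PS_plus,
   PS_scal and PS_mult (Cauchy product) act on coefficient sequences with no
   reference to convergence, so they are the operations of R[[w]]. *)
Definition fps : Type := nat -> R.

Definition fps_const (a : R) : fps :=
  fun n => match n with O => a | S _ => 0 end.

Definition fps_w : fps :=
  fun n => match n with 1%nat => 1 | _ => 0 end.

Fixpoint fps_pow (a : fps) (n : nat) : fps :=
  match n with
  | O => fps_const 1
  | S m => PS_mult a (fps_pow a m)
  end.

(* Convergence of an infinite sum in R[[w]] for the w-adic topology: every
   coefficient of the partial sums is eventually constant, equal to that of s. *)
Definition is_fps_sum (f : nat -> fps) (s : fps) : Prop :=
  forall k : nat,
    eventually (fun N => sum_f_R0 (fun n => f n k) N = s k).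

(* [c_0; ...; c_n]: the recurrence is not structural, hence the table; it is
   recovered in its usual form by catalan_0 and catalan_S below. *)
Fixpoint catalan_table (n : nat) : list nat :=
  match n with
  | O => [1%nat]
  | S m =>
      let l := catalan_table m in
      l ++ [list_sum (map (fun i => nth i l 0 * nth (m - i) l 0)%nat
                          (seq 0 (S m)))]
  end.

Definition catalan (n : nat) : nat := nth n (catalan_table n) 0%nat.

Lemma length_catalan_table (n : nat) : length (catalan_table n) = S n.
Proof.
induction n as [|n IH]; [reflexivity|].
cbn [catalan_table]; rewrite length_app, IH; simpl; lia.
Qed.

Lemma nth_catalan_table (n i : nat) :
  (i <= n)%nat -> nth i (catalan_table n) 0%nat = catalan i.
Proof.
induction n as [|n IH]; intros Hi.
- now replace i with O by lia.
- destruct (Nat.eq_dec i (S n)) as [->|Hne]; [reflexivity|].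
  cbn [catalan_table]; rewrite app_nth1.
  + apply IH; lia.
  + rewrite length_catalan_table; lia.
Qed.

Lemma catalan_0 : catalan 0 = 1%nat.
Proof. reflexivity. Qed.

Lemma catalan_S (n : nat) :
  catalan (S n) =
  list_sum (map (fun i => catalan i * catalan (n - i))%nat (seq 0 (S n))).
Proof.
unfold catalan at 1; cbn [catalan_table].
rewrite app_nth2; rewrite length_catalan_table; [|lia].
rewrite Nat.sub_diag; cbn [nth].
f_equal; apply map_ext_in; intros i Hi; apply in_seq in Hi.
rewrite !nth_catalan_table by lia; reflexivity.
Qed.

(* Main.v *)
Require Import Defs.
From Stdlib Require Import Reals.
From Coquelicot Require Import Coquelicot.
From Stdlib Require Import Lia List Wf_nat FunctionalExtensionality.
Open Scope R_scope.

(** Comparing coefficients, the equation says [v 0 = 0] and that [v (S k)] is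
    the [k]-th coefficient of [A + B v^2], which involves only [v 0, ..., v k];
    hence it has at most one solution. The odd series with coefficients
    [c_n A^(n+1) B^n] at [w^(2n+1)] satisfies this recursion, which on its odd
    coefficients is the Catalan recurrence. *)

Lemma sum_f_R0_zero (f : nat -> R) (N : nat) :
  (forall i, (i <= N)%nat -> f i = 0) -> sum_f_R0 f N = 0.
Proof.
intros Hf; rewrite (sum_eq f (fun _ => 0) N Hf), sum_cte; ring.
Qed.

Lemma sum_f_R0_single (f : nat -> R) (m N : nat) :
  (m <= N)%nat -> (forall i, (i <= N)%nat -> i <> m -> f i = 0) ->
  sum_f_R0 f N = f m.
Proof.
induction N as [|N IH]; intros Hm Hf.
- now replace m with O by lia.
- simpl; destruct (Nat.eq_dec m (S N)) as [->|Hne].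
  + rewrite sum_f_R0_zero; [ring|]; intros i Hi; apply Hf; lia.
  + rewrite IH, (Hf (S N)) by (try lia; intros; apply Hf; lia); ring.
Qed.

(** The left side ends at the even index [2 * S m], whose term vanishes, so exactly the odd indices
    1, ..., 2m + 1 remain. This is the shape of a Cauchy product in even positive degree. *)
Lemma sum_f_R0_odd_support (f : nat -> R) (m : nat) :
  (forall j, f (2 * j)%nat = 0) ->
  sum_f_R0 f (2 * S m) = sum_f_R0 (fun j => f (2 * j + 1)%nat) m.
Proof.
intros Hf; induction m as [|m IH].
- simpl; rewrite (Hf 0%nat : f 0%nat = 0), (Hf 1%nat : f 2%nat = 0); ring.
- replace (2 * S (S m))%nat with (S (S (2 * S m))) by lia.
  rewrite !tech5, IH.
  replace (S (S (2 * S m))) with (2 * S (S m))%nat by lia.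
  rewrite Hf; replace (S (2 * S m)) with (2 * S m + 1)%nat by lia; ring.
Qed.

Lemma INR_list_sum_map_seq (g : nat -> nat) (n : nat) :
  INR (list_sum (map g (seq 0 (S n)))) = sum_f_R0 (fun i => INR (g i)) n.
Proof.
induction n as [|n IH].
- simpl; now rewrite Nat.add_0_r.
- rewrite seq_S, map_app, list_sum_app, plus_INR, IH; simpl.
  now rewrite Nat.add_0_r.
Qed.

(** Reduces [fps_pow v 2], which unfolds to [v] times the product of [v] and 1, to the plain Cauchy
    square. *)
Lemma PS_mult_1_r (a : fps) : PS_mult a (fps_const 1) = a.
Proof.
apply functional_extensionality; intros k; unfold PS_mult.
rewrite (sum_f_R0_single _ k).
- rewrite Nat.sub_diag; simpl; ring.
- lia.
- intros i Hi Hne; destruct (k - i)%nat eqn:E; [lia|simpl; ring].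
Qed.

Lemma PS_mult_w_0 (a : fps) : PS_mult a fps_w 0%nat = 0.
Proof. unfold PS_mult; simpl; ring. Qed.

Lemma PS_mult_w_S (a : fps) (k : nat) : PS_mult a fps_w (S k) = a k.
Proof.
unfold PS_mult; rewrite (sum_f_R0_single _ k).
- replace (S k - k)%nat with 1%nat by lia; simpl; ring.
- lia.
- intros i Hi Hne.
  destruct (S k - i)%nat as [|[|d]] eqn:E; [|lia|]; unfold fps_w; ring.
Qed.

Lemma fps_pow_w (m k : nat) :
  fps_pow fps_w m k = if Nat.eqb k m then 1 else 0.
Proof.
revert k; induction m as [|m IH]; intros k.
- now destruct k.
- cbn [fps_pow]; unfold PS_mult; destruct k as [|k]; [simpl; ring|].
  rewrite (sum_f_R0_single _ 1).
  + rewrite IH, Nat.sub_succ, Nat.sub_0_r; simpl; ring.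
  + lia.
  + intros [|[|i]] _ Hne; [|lia|]; unfold fps_w; ring.
Qed.

(** Multiplication by [fps_w] shifts coefficients up by one and puts 0 in degree zero. Both
    uniqueness and existence are read off from this recursion. *)
Lemma quadratic_fps_equation_coeffs (A B : R) (v : fps) :
  v = PS_mult (PS_plus (fps_const A) (PS_scal B (fps_pow v 2))) fps_w <->
  v 0%nat = 0 /\
  forall k, v (S k) = fps_const A k + B * PS_mult v v k.
Proof.
assert (Hc : forall k,
  PS_plus (fps_const A) (PS_scal B (fps_pow v 2)) k
  = fps_const A k + B * PS_mult v v k).
{ intros k; cbn [fps_pow]; rewrite PS_mult_1_r; reflexivity. }
split.
- intros Hv; split.
  + now rewrite (equal_f Hv 0%nat), PS_mult_w_0.
  + intros k; now rewrite (equal_f Hv (S k)), PS_mult_w_S, Hc.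
- intros [H0 HS]; apply functional_extensionality; intros [|k].
  + now rewrite PS_mult_w_0.
  + now rewrite PS_mult_w_S, Hc.
Qed.

Lemma quadratic_fps_equation_unique (A B : R) (v1 v2 : fps) :
  v1 = PS_mult (PS_plus (fps_const A) (PS_scal B (fps_pow v1 2))) fps_w ->
  v2 = PS_mult (PS_plus (fps_const A) (PS_scal B (fps_pow v2 2))) fps_w ->
  v1 = v2.
Proof.
intros [H10 H1]%quadratic_fps_equation_coeffs
       [H20 H2]%quadratic_fps_equation_coeffs.
apply functional_extensionality; intros k.
induction k as [[|k] IH] using lt_wf_ind; [congruence|].
rewrite H1, H2; do 2 f_equal; apply sum_eq; intros i Hi.
now rewrite !IH by lia.
Qed.

(** Given coefficientwise rather than as a limit: for k = 2n + 1, [Nat.div2 k] is n. *)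
Definition catalan_fps (A B : R) : fps := fun k =>
  if Nat.odd k
  then INR (catalan (Nat.div2 k)) * A ^ (Nat.div2 k + 1) * B ^ Nat.div2 k
  else 0.

Lemma catalan_fps_even (A B : R) (m : nat) : catalan_fps A B (2 * m)%nat = 0.
Proof. unfold catalan_fps; now rewrite Nat.odd_even. Qed.

Lemma catalan_fps_odd (A B : R) (m : nat) :
  catalan_fps A B (2 * m + 1)%nat = INR (catalan m) * A ^ (m + 1) * B ^ m.
Proof.
unfold catalan_fps; rewrite Nat.odd_odd.
now rewrite Nat.add_1_r, Nat.div2_succ_double.
Qed.

Lemma catalan_fps_is_sum (A B : R) :
  is_fps_sum
    (fun n => PS_scal (INR (catalan n) * A ^ (n + 1) * B ^ n)
                      (fps_pow fps_w (2 * n + 1))) (catalan_fps A B).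
Proof.
(* Only n with 2n + 1 = k can contribute to degree k, and such an n is at most k, so the partial
   sums are constant from N = k on. *)
intros k; exists k; intros N HN.
rewrite (sum_eq _ (fun n => INR (catalan n) * A ^ (n + 1) * B ^ n
                            * (if Nat.eqb k (2 * n + 1) then 1 else 0))).
2: { intros n _; now rewrite <- fps_pow_w. }
destruct (Nat.Even_or_Odd k) as [[m ->]|[m ->]].
- rewrite catalan_fps_even; apply sum_f_R0_zero; intros i _.
  destruct (Nat.eqb_spec (2 * m) (2 * i + 1)); [lia|ring].
- rewrite catalan_fps_odd, (sum_f_R0_single _ m).
  + rewrite Nat.eqb_refl; ring.
  + lia.
  + intros i _ Hne.
    destruct (Nat.eqb_spec (2 * m + 1) (2 * i + 1)); [lia|ring].
Qed.

(** The odd degrees 2i + 1 and 2(m - i) + 1 pair up. Each pair carries the same power A^((i+1) +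
    (m-i+1)) B^(i + (m-i)), and factoring it out leaves the Catalan convolution for c_(m+1). *)
Lemma catalan_fps_square_even (A B : R) (m : nat) :
  PS_mult (catalan_fps A B) (catalan_fps A B) (2 * S m)
  = INR (catalan (S m)) * A ^ (m + 2) * B ^ m.
Proof.
unfold PS_mult; rewrite sum_f_R0_odd_support.
- rewrite catalan_S, INR_list_sum_map_seq, Rmult_assoc, Rmult_comm, scal_sum.
  apply sum_eq; intros i Hi.
  replace (2 * S m - (2 * i + 1))%nat with (2 * (m - i) + 1)%nat by lia.
  rewrite !catalan_fps_odd, mult_INR.
  replace (m + 2)%nat with ((i + 1) + (m - i + 1))%nat by lia.
  replace (B ^ m) with (B ^ i * B ^ (m - i)) by
    (rewrite <- pow_add; f_equal; lia).
  rewrite (pow_add A (i + 1)); ring.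
- intros j; rewrite catalan_fps_even; ring.
Qed.

(** Of two degrees with odd sum one is even, so every product has a zero factor. *)
Lemma catalan_fps_square_odd (A B : R) (m : nat) :
  PS_mult (catalan_fps A B) (catalan_fps A B) (2 * m + 1) = 0.
Proof.
apply sum_f_R0_zero; intros i Hi.
destruct (Nat.Even_or_Odd i) as [[j ->]|[j ->]].
- rewrite catalan_fps_even; ring.
- replace (2 * m + 1 - (2 * j + 1))%nat with (2 * (m - j))%nat by lia.
  rewrite catalan_fps_even; ring.
Qed.

Lemma catalan_fps_solution (A B : R) :
  catalan_fps A B =
  PS_mult (PS_plus (fps_const A) (PS_scal B (fps_pow (catalan_fps A B) 2)))
          fps_w.
Proof.
apply quadratic_fps_equation_coeffs; split; [reflexivity|].
intros k; destruct (Nat.Even_or_Odd k) as [[[|m] ->]|[m ->]].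
(* Degree k = 0 gives c_0 A = A: the square has no constant term, and the Catalan recurrence enters
   only from k = 2 on. *)
- unfold PS_mult, catalan_fps; simpl; ring.
- rewrite catalan_fps_square_even.
  replace (S (2 * S m)) with (2 * S m + 1)%nat by lia.
  rewrite catalan_fps_odd; replace (m + 2)%nat with (S m + 1)%nat by lia.
  simpl; ring.
- rewrite catalan_fps_square_odd.
  replace (S (2 * m + 1)) with (2 * S m)%nat by lia.
  rewrite catalan_fps_even, Nat.add_1_r; simpl; ring.
Qed.

Theorem lemma3p3 (A B : R) (hA : A <> 0) :
  exists u : fps,
    is_fps_sum
      (fun n => PS_scal (INR (catalan n) * A ^ (n + 1) * B ^ n)
                        (fps_pow fps_w (2 * n + 1))) u /\
    (forall v : fps,
       v = PS_mult (PS_plus (fps_const A) (PS_scal B (fps_pow v 2))) fps_w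
       <-> v = u).
Proof.
exists (catalan_fps A B); split; [apply catalan_fps_is_sum|].
intros v; split.
- intros Hv; exact (quadratic_fps_equation_unique A B v _ Hv
                      (catalan_fps_solution A B)).
- intros ->; apply catalan_fps_solution.
Qed.
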